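(* Let $A$ be a finite simple distributive group of order $N>1$ and let $g$ be its cycle degree. Then $$N\equiv 1 \pmod g .$$
   Context: A distributive group is a nonempty set $G$ with a binary operation $(a,b)\mapsto a.b$ on $G$ such that for all $a,b\in G$ each of the equations $a.x=b$ and $y.a=b$ has exactly one solution in $G$, and for all $a,b,c\in G$, $(a.b).c=(a.c).(b.c)$ and $c.(a.b)=(c.a).(c.b)$. A subgroup is a nonempty subset which is itself a distributive group under the restricted operation; the order is the number of elements. A distributive group is simple if it has no proper subgroup of order greater than one. For $a,b$ in a finite distributive group write $a^1.b=a.b$ and $a^{r+1}.b=a.(a^r.b)$. For distinct elements $a,b$, the degree of the $l$-cycle of $a,b$ is the smallest integer $r\ge1$ with $a^r.b=b$ (the cycle is $a,\,b,\,a.b,\,a^2.b,\dots,a^{r-1}.b$). In a finite simple distributive group this degree is the same for all pairs of distinct elements; this common value is the cycle degree $g$. *)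

(* Defs.v *)
From mathcomp Require Import all_boot.

Set Implicit Arguments.
Unset Strict Implicit.
Unset Printing Implicit Defensive.

Definition distributive_group (T : Type) (op : T -> T -> T) : Prop :=
  [/\ inhabited T,
      forall a b, exists! x, op a x = b,
      forall a b, exists! y, op y a = b,
      left_distributive op op
    & right_distributive op op].

Definition op_closed (T : finType) (op : T -> T -> T) (S : {set T}) : Prop :=
  {in S &, forall a b, op a b \in S}.

Definition restricted_op (T : finType) (op : T -> T -> T) (S : {set T})
    (clS : op_closed op S) (u v : {x : T | x \in S}) : {x : T | x \in S} :=
  exist _ (op (val u) (val v)) (clS (val u) (val v) (valP u) (valP v)).

Definition subgroup (T : finType) (op : T -> T -> T) (S : {set T}) : Prop :=
  exists clS : op_closed op S, distributive_group (restricted_op clS).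

Definition simple (T : finType) (op : T -> T -> T) : Prop :=
  forall S : {set T}, S \proper [set: T] -> subgroup op S -> ~ 1 < #|S|.

(* a^r.b is [iter r (op a) b]. *)
Definition lcycle_degree (T : finType) (op : T -> T -> T) (a b : T) (r : nat)
    : Prop :=
  [/\ 0 < r, iter r (op a) b = b
    & forall s, 0 < s -> iter s (op a) b = b -> r <= s].

Definition cycle_degree (T : finType) (op : T -> T -> T) (g : nat) : Prop :=
  forall a b : T, a <> b -> lcycle_degree op a b g.

Section WellDefined.

Context (T : finType) (op : T -> T -> T)
  (dgT : distributive_group op) (simT : simple op).

Let op_injr a : injective (op a).
Proof.
case: dgT => _ div _ _ _ x y exy.
by have [z [_ uz]] := div a (op a y); rewrite -(uz x exy) -(uz y erefl).
Qed.

Let op_injl a : injective (op^~ a).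
Proof.
case: dgT => _ _ div _ _ x y exy.
by have [z [_ uz]] := div a (op y a); rewrite -(uz x exy) -(uz y erefl).
Qed.

Let op_idem a : op a a = a.
Proof.
case: dgT => _ _ _ _ rd.
by apply: (@op_injl (op a a)); rewrite /= [RHS]rd.
Qed.

Let subgroup_closed (S : {set T}) x : x \in S -> op_closed op S -> subgroup op S.
Proof.
move=> Sx clS; exists clS; case: dgT => _ _ _ ld rd.
have injr u : injective (restricted_op clS u).
  by move=> v w /(congr1 val)/= /op_injr/val_inj.
have injl u : injective ((restricted_op clS)^~ u).
  by move=> v w /(congr1 val)/= e; apply/val_inj/(@op_injl (val u)).
split.
- by constructor; exists x.
- move=> u v; have [h _ hK] := injF_bij (injr u).
  by exists (h v); split=> [|w <-]; [exact: hK | apply: (injr u); rewrite hK].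
- move=> u v; have [h _ hK] := injF_bij (injl u).
  by exists (h v); split=> [|w <-]; [exact: hK | apply: (injl u); rewrite hK].
- by move=> u v w; apply: val_inj; exact: ld.
- by move=> u v w; apply: val_inj; exact: rd.
Qed.

Let iter_morph a r : {morph iter r (op a) : x y / op x y}.
Proof.
case: dgT => _ _ _ _ rd.
by move=> x y; elim: r => //= r ->; rewrite rd.
Qed.

Let iter_fix a r : iter r (op a) a = a.
Proof. by elim: r => //= r ->. Qed.

Let iter_id a b r : a <> b -> iter r (op a) b = b ->
  forall x, iter r (op a) x = x.
Proof.
move=> ab fb x; pose S := [set y | iter r (op a) y == y].
have Sa : a \in S by rewrite inE iter_fix.
have Sb : b \in S by rewrite inE fb.
have clS : op_closed op S.
  by move=> y z; rewrite !inE iter_morph => /eqP-> /eqP->.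
have S2 : 1 < #|S|.
  by apply/card_gt1P; exists a, b; split=> //; apply/eqP.
have /negP nS : ~ S \proper setT.
  by move=> pS; exact: (simT pS (subgroup_closed Sa clS)).
have : x \in S by move: nS; rewrite properT negbK => /eqP->; rewrite inE.
by rewrite inE => /eqP.
Qed.

Let iter_conj c a r x : iter r (op (op c a)) (op c x) = op c (iter r (op a) x).
Proof.
case: dgT => _ _ _ _ rd.
by elim: r => //= r ->; rewrite -rd.
Qed.

Let degree_ex a b : exists r, lcycle_degree op a b r.
Proof.
have ex : exists r, (0 < r) && (iter r (op a) b == b).
  exists (order (op a) b); rewrite order_gt0 /=.
  by apply/eqP/iter_order; exact: op_injr.
case: (ex_minnP ex) => r /andP[r0 /eqP rb] rmin.
by exists r; split=> // s s0 sb; apply: rmin; rewrite s0 sb eqxx.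
Qed.

(* The cycle degree of a finite simple distributive group is well defined. *)
Lemma cycle_degree_exists_unique :
  1 < #|T| -> exists! g : nat, cycle_degree op g.
Proof.
case/card_gt1P=> a [b [_ _ /eqP ab]].
have [g [g0 gb gmin]] := degree_ex a b.
exists g; split; last first.
  move=> h /(_ a b ab)[h0 hb hmin].
  by apply/eqP; rewrite eqn_leq gmin // hmin.
move=> c d cd.
have [y ey] : exists y, op y a = c.
  by case: dgT => _ _ /(_ a c)[y [ey _]] _ _; exists y.
have onto x : exists z, x = op y z.
  by case: dgT => _ /(_ y x)[z [ez _]] _ _ _; exists z.
split=> //.
  have [z ->] := onto d.
  by rewrite -ey iter_conj (iter_id ab gb).
move=> s s0 /(iter_id cd) sid; apply: gmin => //.
by apply: (@op_injr y); rewrite -iter_conj ey sid.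
Qed.

End WellDefined.

(* Main.v *)
Require Import Defs.
From mathcomp Require Import all_boot.

(** Fix an element [a]. Left translation by [a] is injective, and it fixes [a]
    because a distributive group is idempotent. The orbit of any other element
    [b] is the l-cycle of [a] and [b] with its initial [a] removed, so by
    definition of the cycle degree it has [g] elements. These orbits partition
    the complement of [a], whence [g] divides [#|T| - 1]. *)

(** Translates the minimality that defines the cycle degree into the orbit
    sizes that [fcard_order_set] counts. *)
Lemma least_period_order (T : finType) (f : T -> T) (x : T) (r : nat) :
    injective f -> 0 < r -> iter r f x = x ->
    (forall s, 0 < s -> iter s f x = x -> r <= s) ->
  order f x = r.
Proof.
move=> injf r0 rx rmin; apply/eqP; rewrite eqn_leq.
rewrite (rmin _ (order_gt0 f x) (iter_order injf x)) andbT leqNgt.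
(* The first [order f x] iterates are distinct, so a shorter period is zero. *)
apply/negP=> ltr; have := findex_iter ltr.
by rewrite rx findex0 => r00; rewrite -r00 in r0.
Qed.

Lemma distributive_group_injective (T : Type) (op : T -> T -> T) (a : T) :
  distributive_group op -> injective (op a).
Proof.
case=> _ div _ _ _ x y exy.
by have [z [_ uz]] := div a (op a y); rewrite -(uz x exy) -(uz y erefl).
Qed.

(** Right distributivity gives [a.(a.a) = (a.a).(a.a)], where the right factor
    [a.a] cancels. *)
Lemma distributive_group_idempotent (T : Type) (op : T -> T -> T) (a : T) :
  distributive_group op -> op a a = a.
Proof.
case=> _ _ div _ rd.
have [z [_ uz]] := div (op a a) (op a (op a a)).
by rewrite -[RHS](uz a erefl) -(uz (op a a) (esym (rd a a a))).
Qed.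

Theorem theorem5p14 (T : finType) (op : T -> T -> T) (g : nat)
    (dgT : distributive_group op) (simT : simple op)
    (cardT : 1 < #|T|) (deg : cycle_degree op g) :
  #|T| = 1 %[mod g].
Proof.
have [a _] : exists a : T, a \in T by apply/card_gt0P/ltnW.
have inja := @distributive_group_injective T op a dgT.
have aa := @distributive_group_idempotent T op a dgT.
have orders : predC1 a \subset order_set (op a) g.
  apply/subsetP=> x; rewrite !inE => xa.
  have [|g0 gx gmin] := deg a x; first by move=> ax; rewrite ax eqxx in xa.
  by apply/eqP/least_period_order.
have closed_compl : fclosed (op a) (predC1 a).
  by move=> x y /eqP <-; rewrite !inE -[X in _ = (_ != X)]aa (inj_eq inja).
have card_compl := fcard_order_set inja orders closed_compl.
by rewrite -(ltn_predK cardT) -(cardC1 a) -card_compl -addn1 modnMDl.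
Qed.
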